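(* Let $0\le m<n$ be integers and let $A$ be an $n\times n$ real symmetric matrix with eigenvalues $\lambda_1(A),\dots,\lambda_n(A)$, indexed in nondecreasing order, and corresponding eigenvectors $v_1(A),\dots,v_n(A)$. The optimal solutions to $$\underset{X}{\text{minimize}}\ \|X-A\|_F\quad\text{subject to}\quad X\in\mathcal{L}_{m,n}$$ for which $v_k(X)=v_k(A)$ for all $k\in\{1,\dots,n\}$ are precisely those such that $$\lambda_i(X)=\lambda=\frac{\lambda_l(A)+\lambda_{l+1}(A)+\dots+\lambda_{l+n-m-1}(A)}{n-m}\quad\text{if } i\in\{l,\dots,l+n-m-1\},$$ $\lambda_i(X)=\lambda_i(A)$ otherwise, and $l$ is an integer (in $\{1,\dots,m+1\}$) that minimizes $\sum_{i=l}^{l+n-m-1}(\lambda_i(A)-\lambda)^2$, where $\lambda$ depends on $l$ as displayed.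
   Context: $\mathcal{L}_{m,n}$ denotes the set of real $n\times n$ matrices $M$ that can be written as $M=\beta I+\sum_{i=1}^m a_iu_iu_i^T$ with $\beta,a_i\in\mathbb{R}$ and $u_i\in\mathbb{R}^n$. $\|\cdot\|_F$ is the Frobenius norm. The eigenvectors $v_1(A),\dots,v_n(A)$ form a fixed orthonormal basis, with $v_k(A)$ belonging to $\lambda_k(A)$. The condition $v_k(X)=v_k(A)$ for all $k$ means that each $v_k(A)$ is an eigenvector of $X$, and $\lambda_k(X)$ then denotes the eigenvalue of $X$ belonging to that eigenvector (so the $\lambda_k(X)$ are indexed by the eigenvectors of $A$).
   Formalization: With repeated eigenvalues of A, ''precisely those'' fails for a fixed indexing (e.g. diag(0,0,1,1,1), m=1); the displayed form is required only for some nondecreasing re-indexing of A's same eigenpairs, and literally when the eigenvalues of X are nondecreasing. *)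

(* Defs.v *)
From mathcomp Require Import all_boot all_order all_algebra all_fingroup.
From mathcomp Require Import reals.

Set Implicit Arguments.
Unset Strict Implicit.
Unset Printing Implicit Defensive.

Import Order.TTheory GRing.Theory Num.Theory.
Local Open Scope ring_scope.

Definition frobenius_norm (R : realType) (n : nat) (M : 'M[R]_n) : R :=
  Num.sqrt (\sum_(i < n) \sum_(j < n) M i j ^+ 2).

Definition in_L (R : realType) (m n : nat) (M : 'M[R]_n) : Prop :=
  exists (beta : R) (a : 'I_m -> R) (u : 'I_m -> 'cV[R]_n),
    M = beta%:M + \sum_(i < m) a i *: (u i *m (u i)^T).

Definition optimal_solution (R : realType) (m n : nat) (A X : 'M[R]_n) : Prop :=
  in_L m X /\
  forall Y : 'M[R]_n, in_L m Y -> frobenius_norm (X - A) <= frobenius_norm (Y - A).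

Definition orthonormal_family (R : realType) (n : nat) (v : 'I_n -> 'cV[R]_n) : Prop :=
  forall i j : 'I_n, (v i)^T *m v j = (i == j)%:R%:M.

(* Each [v k] is an eigenvector of [M], with eigenvalue [mu k]; the vectors are
   nonzero as soon as they are orthonormal, and [mu] is then determined by [M]
   and [v]. *)
Definition eigenpairs (R : realType) (n : nat) (M : 'M[R]_n)
    (mu : 'I_n -> R) (v : 'I_n -> 'cV[R]_n) : Prop :=
  forall k : 'I_n, M *m v k = mu k *: v k.

Definition nondecreasing_eigenvalues (R : realType) (n : nat) (mu : 'I_n -> R) : Prop :=
  forall i j : 'I_n, (i <= j)%N -> mu i <= mu j.

(* Indices start at 0: [window m n l] with [l <= m] is the set of [n - m]
   consecutive indices written {l+1, ..., l+n-m} when indices start at 1. *)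
Definition window (m n l : nat) : {set 'I_n} :=
  [set i : 'I_n | (l <= i < l + (n - m))%N].

Definition window_mean (R : realType) (m n : nat) (lam : 'I_n -> R) (l : nat) : R :=
  (\sum_(i in window m n l) lam i) / (n - m)%:R.

Definition window_cost (R : realType) (m n : nat) (lam : 'I_n -> R) (l : nat) : R :=
  \sum_(i in window m n l) (lam i - window_mean m lam l) ^+ 2.

Definition minimizing_window (R : realType) (m n : nat) (lam : 'I_n -> R)
    (l : 'I_m.+1) : Prop :=
  forall l' : 'I_m.+1, window_cost m lam l <= window_cost m lam l'.

Definition window_averaged (R : realType) (m n : nat) (lam : 'I_n -> R) (l : nat)
    (i : 'I_n) : R :=
  if i \in window m n l then window_mean m lam l else lam i.

(* Main.v *)
(* If [Y = beta I + sum a_i u_i u_i^T] and [P] is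
   the orthogonal projection onto the complement of the [u_i], then [P Y = beta P]
   and [|Y - A|^2 >= |P (Y - A)|^2 = sum_k (lam_k - beta)^2 |P v_k|^2], where the
   weights [|P v_k|^2] lie in [0, 1] and sum to at least [n - m].  Such a weighted
   sum is at least the sum over the [n - m] eigenvalues nearest to [beta], which
   form a window, and replacing [beta] by the mean of the window lowers the cost
   further.  In the case of equality, any [n - m] indices where [mu = beta] form an
   order-convex set of values of [lam], hence a window up to ties. *)
Require Import Defs.
From mathcomp Require Import all_boot all_order all_algebra all_fingroup.
From mathcomp Require Import reals ring lra zify.

Set Implicit Arguments.
Unset Strict Implicit.
Unset Printing Implicit Defensive.

Import Order.TTheory GRing.Theory Num.Theory.
Local Open Scope ring_scope.

(** * Squared Frobenius norm and orthogonal projections *)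

Definition sqnorm (R : realType) (p q : nat) (M : 'M[R]_(p, q)) : R := \tr (M^T *m M).

Lemma sqnormE (R : realType) (p q : nat) (M : 'M[R]_(p, q)) :
  sqnorm M = \sum_i \sum_j M i j ^+ 2.
Proof.
rewrite /sqnorm /mxtrace exchange_big /=; apply: eq_bigr => j _.
by rewrite mxE; apply: eq_bigr => i _; rewrite mxE expr2.
Qed.

Lemma sqnorm_ge0 (R : realType) (p q : nat) (M : 'M[R]_(p, q)) : 0 <= sqnorm M.
Proof. by rewrite sqnormE; do 2![apply: sumr_ge0 => ? _]; apply: sqr_ge0. Qed.

Lemma sqnorm_eq0 (R : realType) (p q : nat) (M : 'M[R]_(p, q)) : sqnorm M = 0 -> M = 0.
Proof.
rewrite sqnormE => /eqP.
rewrite psumr_eq0 => [/allP h|i _]; last by apply: sumr_ge0 => j _; apply: sqr_ge0.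
apply/matrixP => i j; rewrite mxE.
have := h i (mem_index_enum i); rewrite /= psumr_eq0 => [/allP h'|k _]; last exact: sqr_ge0.
by have := h' j (mem_index_enum j); rewrite /= sqrf_eq0 => /eqP.
Qed.

Lemma sqnormZ (R : realType) (p q : nat) (c : R) (M : 'M[R]_(p, q)) :
  sqnorm (c *: M) = c ^+ 2 * sqnorm M.
Proof. by rewrite /sqnorm [(c *: M)^T]linearZ /= -scalemxAl -scalemxAr !mxtraceZ mulrA expr2. Qed.

Lemma frobenius_normE (R : realType) (n : nat) (M : 'M[R]_n) :
  frobenius_norm M = Num.sqrt (sqnorm M).
Proof. by rewrite /frobenius_norm sqnormE. Qed.

Lemma frobenius_norm_le (R : realType) (n : nat) (M N : 'M[R]_n) :
  (frobenius_norm M <= frobenius_norm N) = (sqnorm M <= sqnorm N).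
Proof. by rewrite !frobenius_normE ler_psqrt // nnegrE sqnorm_ge0. Qed.

Definition orth_proj (R : realType) (n : nat) (P : 'M[R]_n) : Prop :=
  P^T = P /\ P *m P = P.

(** Pythagoras: [M] splits into the orthogonal pieces [P *m M] and [(1%:M - P) *m M]. *)
Lemma sqnorm_orth_proj_le (R : realType) (n q : nat) (P : 'M[R]_n) (M : 'M[R]_(n, q)) :
  orth_proj P -> sqnorm (P *m M) <= sqnorm M.
Proof.
move=> [PT PP].
have -> : sqnorm M = sqnorm (P *m M) + sqnorm ((1%:M - P) *m M).
  rewrite /sqnorm !trmx_mul linearB /= PT trmx1 -!mulmxA -mxtraceD.
  rewrite (mulmxA P P) PP (mulmxA (1%:M - P)) mulmxBl !mulmxBr !mul1mx mulmx1 PP.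
  by rewrite subrr subr0 -mulmxDr -mulmxDl addrCA subrr addr0 mul1mx.
by rewrite lerDl sqnorm_ge0.
Qed.

Lemma sqnorm_orth_proj (R : realType) (n : nat) (P : 'M[R]_n) :
  orth_proj P -> sqnorm P = \tr P.
Proof. by rewrite /sqnorm => -[-> ->]. Qed.

(** With the rows of [B] a basis of the left kernel of [U], the projection is [B^T (B B^T)^-1 B]. By
    cyclicity its trace is the number of rows of [B], which is [n - rank U]. *)
Lemma orth_proj_kermx (R : realType) (n m : nat) (U : 'M[R]_(n, m)) :
  exists P : 'M[R]_n, [/\ orth_proj P, P *m U = 0 & (n - m)%:R <= \tr P].
Proof.
set B := row_base (kermx U).
have BU : B *m U = 0 by apply/sub_kermxP; rewrite eq_row_base.
have Bfree : row_free B by apply: row_base_free.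
clearbody B; set G := B *m B^T.
have Gu : G \in unitmx.
  (* The Gram matrix is invertible: [x *m G = 0] forces [|x B|^2 = x G x^T = 0], and the rows of [B]
     are free. *)
  rewrite -row_free_unit; apply: inj_row_free => x xG.
  have : sqnorm (x *m B)^T = 0.
    by rewrite /sqnorm trmxK trmx_mul -mulmxA (mulmxA B) (mulmxA x) xG mul0mx mxtrace0.
  move/sqnorm_eq0/(congr1 trmx); rewrite trmxK trmx0 => xB.
  by apply: (row_free_inj Bfree); rewrite mul0mx.
have GT : G^T = G by rewrite /G trmx_mul trmxK.
exists (B^T *m invmx G *m B); split; first split.
- by rewrite !trmx_mul trmxK trmx_inv GT mulmxA.
- by rewrite !mulmxA -(mulmxA _ B) -(mulmxA _ (invmx G) (B *m _)) mulVmx // mulmx1.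
- by rewrite -(mulmxA _ B U) BU mulmx0.
rewrite mxtrace_mulC mulmxA -/G mulmxV // mxtrace1 ler_nat mxrank_ker.
by apply: leq_sub2l; apply: rank_leq_col.
Qed.

(** Choosing [P] to kill every [u i] removes the rank-one terms and leaves only [beta]. *)
Lemma in_L_orth_proj (R : realType) (m n : nat) (Y : 'M[R]_n) :
  in_L m Y ->
  exists (beta : R) (P : 'M[R]_n),
    [/\ orth_proj P, P *m Y = beta *: P & (n - m)%:R <= \tr P].
Proof.
move=> [beta [a [u ->]]].
have [P [Pp PU Pt]] := orth_proj_kermx (\matrix_(i < n, j < m) u j i 0).
exists beta, P; split=> //.
rewrite mulmxDr mul_mx_scalar mulmx_sumr big1 ?addr0 // => j _.
rewrite -scalemxAr mulmxA.
suff -> : P *m u j = 0 by rewrite mul0mx scaler0.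
have -> : u j = col j (\matrix_(i < n, j < m) u j i 0).
  by apply/matrixP => i k; rewrite !mxE ord1.
by rewrite colE mulmxA PU mul0mx.
Qed.

(** * Expansion in an orthonormal basis of eigenvectors *)

Lemma orthonormal_sqnorm (R : realType) (n : nat) (v : 'I_n -> 'cV[R]_n) (k : 'I_n) :
  orthonormal_family v -> sqnorm (v k) = 1.
Proof. by move=> hv; rewrite /sqnorm hv eqxx mxtrace1. Qed.

Definition cols_mx (R : realType) (n : nat) (v : 'I_n -> 'cV[R]_n) : 'M[R]_n :=
  \matrix_(i, j) v j i 0.

Lemma mul_cols_mx (R : realType) (n p : nat) (M : 'M[R]_(p, n)) (v : 'I_n -> 'cV[R]_n)
    (i : 'I_p) (k : 'I_n) :
  (M *m cols_mx v) i k = (M *m v k) i 0.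
Proof. by rewrite !mxE; apply: eq_bigr => j _; rewrite mxE. Qed.

Lemma cols_mx_orthonormal (R : realType) (n : nat) (v : 'I_n -> 'cV[R]_n) :
  orthonormal_family v -> cols_mx v *m (cols_mx v)^T = 1%:M.
Proof.
move=> hv; apply: mulmx1C; apply/matrixP => i j.
have := congr1 (fun M : 'M_1 => M 0 0) (hv i j).
rewrite !mxE eqxx mulr1n => <-; apply: eq_bigr => k _; by rewrite !mxE.
Qed.

Lemma sqnorm_orthonormal (R : realType) (n p : nat) (v : 'I_n -> 'cV[R]_n)
    (M : 'M[R]_(p, n)) :
  orthonormal_family v -> sqnorm M = \sum_k sqnorm (M *m v k).
Proof.
move=> hv.
have -> : sqnorm M = sqnorm (M *m cols_mx v).
  rewrite /sqnorm trmx_mul -mulmxA [RHS]mxtrace_mulC -!mulmxA.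
  by rewrite cols_mx_orthonormal // mulmx1.
rewrite sqnormE exchange_big /=; apply: eq_bigr => k _.
rewrite sqnormE; apply: eq_bigr => i _; rewrite big_ord1.
by rewrite mul_cols_mx.
Qed.

Lemma sqnorm_eigenpairs_sub (R : realType) (n : nat) (A X : 'M[R]_n)
    (lam mu : 'I_n -> R) (v : 'I_n -> 'cV[R]_n) :
  orthonormal_family v -> eigenpairs A lam v -> eigenpairs X mu v ->
  sqnorm (X - A) = \sum_k (mu k - lam k) ^+ 2.
Proof.
move=> hv hA hX; rewrite (sqnorm_orthonormal _ hv); apply: eq_bigr => k _.
by rewrite mulmxBl hA hX -scalerBl sqnormZ orthonormal_sqnorm // mulr1.
Qed.

(** Evaluating [P X v_k] in two ways gives [(mu k - beta) P v_k = 0]. So only indices with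
    [mu k = beta] contribute to [tr P = sum_k |P v_k|^2], each at most 1, while [tr P] is at least
    [n - m]. *)
Lemma in_L_eigenvalue_multiplicity (R : realType) (m n : nat) (X : 'M[R]_n)
    (mu : 'I_n -> R) (v : 'I_n -> 'cV[R]_n) :
  orthonormal_family v -> eigenpairs X mu v -> in_L m X ->
  exists beta : R, (n - m <= #|[set k | mu k == beta]|)%N.
Proof.
move=> hv hX /in_L_orth_proj [beta [P [Pp PX Pt]]]; exists beta.
rewrite -(ler_nat R); apply: le_trans Pt _.
rewrite -sqnorm_orth_proj // (sqnorm_orthonormal _ hv) -sum1_card natr_sum.
rewrite [leRHS]big_mkcond /=; apply: ler_sum => k _; rewrite inE.
case: eqP => [_|/eqP ne]; first by rewrite -(orthonormal_sqnorm k hv) sqnorm_orth_proj_le.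
have : (mu k - beta) *: (P *m v k) = 0.
  by rewrite scalerBl scalemxAr -hX mulmxA PX -scalemxAl subrr.
move/eqP; rewrite scaler_eq0 subr_eq0 (negPf ne) => /eqP ->.
by rewrite /sqnorm mulmx0 mxtrace0.
Qed.

(** In the spectral decomposition of [X - beta I] the terms indexed by [T] vanish, so [m] rank-one
    terms remain. *)
Lemma in_L_of_eigenpairs (R : realType) (m n : nat) (X : 'M[R]_n)
    (mu : 'I_n -> R) (v : 'I_n -> 'cV[R]_n) (beta : R) (T : {set 'I_n}) :
  orthonormal_family v -> eigenpairs X mu v ->
  #|~: T| = m -> (forall k, k \in T -> mu k = beta) -> in_L m X.
Proof.
move=> hv hX <- hT.
exists beta, (fun i => mu (enum_val i) - beta), (fun i => v (enum_val i)).
rewrite -(big_enum_val (fun k => (mu k - beta) *: (v k *m (v k)^T))) /=.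
have VT := cols_mx_orthonormal hv.
(* The matrix with columns [v k] is invertible, so it suffices to compare both sides on each
   [v k]. *)
apply: (can_inj (mulmxK (proj1 (mulmx1_unit VT)))).
apply/matrixP => i k.
rewrite !mul_cols_mx; congr (fun_of_matrix _ i 0).
rewrite hX mulmxDl mulmx_suml mul_scalar_mx.
have -> : \sum_(j in ~: T) (mu j - beta) *: (v j *m (v j)^T) *m v k
  = \sum_(j in ~: T) (if j == k then (mu k - beta) *: v k else 0).
  apply: eq_bigr => j _; rewrite -scalemxAl -mulmxA hv.
  by case: eqP => [->|_]; rewrite mul_mx_scalar ?scale1r // scale0r scaler0.
rewrite -big_mkcondr /=; case: (boolP (k \in T)) => kT.
  rewrite big_pred0 ?addr0 ?hT // => j.
  by apply/negP => /andP[+ /eqP jk]; rewrite jk inE kT.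
rewrite (big_pred1 k) => [|j]; first by rewrite -scalerDl addrC subrK.
by rewrite /= inE; case: eqP => [->|]; rewrite ?andbF ?andbT.
Qed.

(** * Windows and weighted sums of squared distances *)

Lemma card_window (m n l : nat) : (m < n)%N -> (l <= m)%N -> #|window m n l| = (n - m)%N.
Proof.
move=> mn lm.
have lt (i : 'I_(n - m)) : (l + i < n)%N by have := ltn_ord i; lia.
pose f i := Ordinal (lt i).
have fi : injective f by move=> i j /(congr1 val) /= /addnI /val_inj.
rewrite -[RHS]card_ord -(card_image fi); apply: eq_card => k; rewrite inE.
apply/idP/imageP => [/andP[lk kl]|[i _ ->] /=]; last by have := ltn_ord i; lia.
have h : (k - l < n - m)%N by lia.
by exists (Ordinal h) => //; apply: val_inj => /=; lia.
Qed.

Lemma exists_subset_card (T : finType) (A : {set T}) (r : nat) :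
  (r <= #|A|)%N -> exists2 B : {set T}, B \subset A & #|B| = r.
Proof.
move=> rA; exists [set x in take r (enum A)].
  by apply/subsetP => x; rewrite inE => /mem_take; rewrite mem_enum.
rewrite cardsE; have /card_uniqP -> : uniq (take r (enum A)) by rewrite take_uniq ?enum_uniq.
by rewrite size_takel // -cardE.
Qed.

(** A threshold [t] separates the values of [c] on [S] from those off [S]. Hence [(c i - t) * (p i -
    [i in S]) >= 0] for every [i]; summing and using [t >= 0] with the bound on the total weight
    gives the claim. *)
Lemma sum_le_fractional (R : realType) (T : finType) (S : {set T}) (c p : T -> R) :
  (forall i, 0 <= c i) -> (forall i, 0 <= p i <= 1) ->
  (forall i j, i \in S -> j \notin S -> c i <= c j) ->
  #|S|%:R <= \sum_i p i ->
  \sum_(i in S) c i <= \sum_i c i * p i.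
Proof.
move=> c0 p01 sep hp.
(* The default 0 covers an empty [S]; it stays below all values since [c] is nonnegative. *)
pose t := \big[Order.max/0]_(i in S) c i.
have t0 : 0 <= t by apply: bigmax_ge_id.
have tS i : i \in S -> c i <= t by move=> iS; apply: le_bigmax_cond.
have tN j : j \notin S -> t <= c j.
  by move=> jS; apply: bigmax_le => // i iS; apply: sep.
have key i : (if i \in S then c i else 0) + t * p i <= c i * p i + (if i \in S then t else 0).
  have /andP[p0 p1] := p01 i.
  case: ifPn => iS; [have := tS _ iS|have := tN _ iS]; nra.
have : \sum_i ((if i \in S then c i else 0) + t * p i)
    <= \sum_i (c i * p i + (if i \in S then t else 0)) by apply: ler_sum => i _.
rewrite !big_split /= -!big_mkcond /= -mulr_sumr sumr_const -mulr_natr.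
have := ler_wpM2l t0 hp; lra.
Qed.

(** Slide the window to the right from 0 and stop as soon as the next value on the right is no
    nearer to [beta] than the leftmost value inside. *)
Lemma exists_nearest_window (R : realType) (m n : nat) (lam : 'I_n -> R) (beta : R) :
  (m < n)%N -> nondecreasing_eigenvalues lam ->
  exists l : 'I_m.+1, forall i j, i \in window m n l -> j \notin window m n l ->
    (lam i - beta) ^+ 2 <= (lam j - beta) ^+ 2.
Proof.
move=> mn hlam.
have sqr_le x y : 0 <= (y - x) * (y + x - 2 * beta) -> (x - beta) ^+ 2 <= (y - beta) ^+ 2.
  by move=> h; rewrite -subr_ge0; apply: le_trans h _; rewrite le_eqVlt; apply/orP; left; apply/eqP; ring.
have n0 : (0 < n)%N by lia.
pose f k := lam (insubd (Ordinal n0) k).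
have fE (i : 'I_n) : f i = lam i.
  by congr lam; apply: val_inj; rewrite val_insubd ltn_ord.
have fle i j : (i <= j < n)%N -> f i <= f j.
  case/andP=> ij jn; apply: hlam; rewrite !val_insubd.
  by rewrite (leq_ltn_trans ij jn) jn.
(* [Q l] is the stopping test. At [l = m] the index [l + (n - m)] falls outside the range, so
   stopping is imposed there. *)
pose Q l := (l == m) || (2 * beta <= f l + f (l + (n - m))%N).
have exQ : exists l, Q l by exists m; rewrite /Q eqxx.
case: (ex_minnP exQ) => l Ql lmin.
have lm : (l <= m)%N by apply: lmin; rewrite /Q eqxx.
exists (Ordinal (lm : (l < m.+1)%N)) => i j; rewrite !inE /= -!fE.
move=> /andP[li il]; rewrite negb_and -!ltnNge.
have iN := ltn_ord i; have jN := ltn_ord j.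
have [jl|lj] := ltnP j l => /= jw.
  (* For [j] to the left, the failed test at [l.-1] gives [f j + f i < 2 * beta]. For [j] to the
     right, handled below, the test at [l] gives the opposite weak inequality. *)
  have l1 : (l.-1 < l)%N by lia.
  have : ~~ Q l.-1 by apply/negP => /lmin; lia.
  rewrite /Q negb_or -ltNge => /andP[_ h].
  have := fle j l.-1; have := fle i (l.-1 + (n - m))%N; have := fle j i.
  have -> : (j <= i < n)%N by lia.
  have -> : (i <= l.-1 + (n - m) < n)%N by lia.
  have -> : (j <= l.-1 < n)%N by lia.
  move=> /(_ isT) h1 /(_ isT) h2 /(_ isT) h3; apply: sqr_le; apply: mulr_le0; lra.
case/orP: Ql => [/eqP ?|h]; first lia.
have := fle l i; have := fle (l + (n - m))%N j; have := fle i j.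
have -> : (i <= j < n)%N by lia.
have -> : (l + (n - m) <= j < n)%N by lia.
have -> : (l <= i < n)%N by lia.
move=> /(_ isT) h1 /(_ isT) h2 /(_ isT) h3; apply: sqr_le; apply: mulr_ge0; lra.
Qed.

(** The variance decomposition about the mean: the cross term vanishes. *)
Lemma sum_sqr_window (R : realType) (m n l : nat) (lam : 'I_n -> R) (beta : R) :
  (m < n)%N -> (l <= m)%N ->
  \sum_(i in window m n l) (lam i - beta) ^+ 2 =
    window_cost m lam l + (n - m)%:R * (window_mean m lam l - beta) ^+ 2.
Proof.
move=> mn lm; rewrite /window_cost; set w := window_mean m lam l.
have r0 : (n - m)%:R != 0 :> R by rewrite pnatr_eq0; lia.
have wE : \sum_(i in window m n l) lam i = w * (n - m)%:R by rewrite mulfVK.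
have E c : \sum_(i in window m n l) (lam i - c) ^+ 2 =
    \sum_(i in window m n l) lam i ^+ 2 - 2 * c * (w * (n - m)%:R) + (n - m)%:R * c ^+ 2.
  rewrite -wE mulr_sumr -sumrB -(card_window mn lm) [#|_|%:R * _]mulr_natl -sumr_const.
  by rewrite -big_split /=; apply: eq_bigr => i _; ring.
by rewrite !E; ring.
Qed.

Lemma minimizing_window_le (R : realType) (m n : nat) (lam p : 'I_n -> R) (beta : R)
    (l : 'I_m.+1) :
  (m < n)%N -> nondecreasing_eigenvalues lam -> minimizing_window lam l ->
  (forall i, 0 <= p i <= 1) -> (n - m)%:R <= \sum_i p i ->
  window_cost m lam l <= \sum_i (lam i - beta) ^+ 2 * p i.
Proof.
move=> mn hlam hl p01 hp.
have [l' sep] := exists_nearest_window beta mn hlam.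
have l'm : (l' <= m)%N by rewrite -ltnS.
apply: le_trans (hl l') _.
have := @sum_le_fractional _ _ _ (fun i => (lam i - beta) ^+ 2) p
  (fun i => sqr_ge0 _) p01 sep.
rewrite card_window // => /(_ hp); apply: le_trans.
by rewrite sum_sqr_window // lerDl mulr_ge0 ?sqr_ge0.
Qed.

Lemma minimizing_window_le_set (R : realType) (m n : nat) (lam : 'I_n -> R) (beta : R)
    (l : 'I_m.+1) (T : {set 'I_n}) :
  (m < n)%N -> nondecreasing_eigenvalues lam -> minimizing_window lam l ->
  #|T| = (n - m)%N -> window_cost m lam l <= \sum_(i in T) (lam i - beta) ^+ 2.
Proof.
move=> mn hlam hl hT.
have := @minimizing_window_le _ _ _ lam (fun i => (i \in T)%:R) beta l mn hlam hl.
have -> : \sum_i (lam i - beta) ^+ 2 * (i \in T)%:R = \sum_(i in T) (lam i - beta) ^+ 2.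
  by rewrite [RHS]big_mkcond; apply: eq_bigr => i _; case: ifP; rewrite ?mulr1 ?mulr0.
apply; first by move=> i; case: (i \in T); rewrite ?lexx ler01.
by rewrite -natr_sum -big_mkcond sum1_card hT.
Qed.

Lemma exists_minimizing_window (R : realType) (m n : nat) (lam : 'I_n -> R) :
  exists l : 'I_m.+1, minimizing_window lam l.
Proof.
exists [arg min_(l < ord0) window_cost m lam (l : 'I_m.+1)]%O => l.
by case: arg_minP => // l0 _; apply.
Qed.

(** * Rearrangements and ties *)

Lemma nondecreasing_perm (R : realType) (n : nat) (f : 'I_n -> R) (s : 'S_n) :
  nondecreasing_eigenvalues f -> nondecreasing_eigenvalues (f \o s) -> f \o s =1 f.
Proof.
move=> hf hfs.
have srt (g : 'I_n -> R) : nondecreasing_eigenvalues g -> sorted <=%R [seq g i | i <- enum 'I_n].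
  move=> hg; rewrite sorted_map.
  apply: (@sub_sorted _ (relpre val leq)) => [i j|]; first exact: hg.
  by rewrite -sorted_map val_enum_ord iota_sorted.
have : [seq (f \o s) i | i <- enum 'I_n] = [seq f i | i <- enum 'I_n].
  apply: (sorted_eq le_trans le_anti); [exact: srt|exact: srt|].
  rewrite (map_comp f s); apply: perm_map; apply: uniq_perm.
  - by rewrite (map_inj_uniq perm_inj) enum_uniq.
  - exact: enum_uniq.
  move=> i; rewrite mem_enum; apply/mapP; exists ((s^-1)%g i); first by rewrite mem_enum.
  by rewrite permKV.
by move=> /eq_in_map h i; apply: h; rewrite mem_enum.
Qed.

(* Listing the indices left of [T], then [T], then the others, each block in
   increasing order, gives the permutation. *)
Lemma convex_set_window (R : realType) (m n : nat) (lam : 'I_n -> R) (T : {set 'I_n}) :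
  (m < n)%N -> nondecreasing_eigenvalues lam -> #|T| = (n - m)%N ->
  (forall i j k, i \in T -> j \in T -> lam i < lam k -> lam k < lam j -> k \in T) ->
  exists (s : 'S_n) (l : 'I_m.+1),
    lam \o s =1 lam /\ forall i, (s i \in T) = (i \in window m n l).
Proof.
move=> mn hlam cT cvx.
(* [L] is cut out by values, not positions: an index outside [T] may tie with values on [T] and sit
   between its positions. *)
pose L := [set k | (k \notin T) && [forall j in T, lam k <= lam j]].
pose H := [set k | (k \notin T) && (k \notin L)].
pose e := enum L ++ enum T ++ enum H.
have e_uniq : uniq e.
  rewrite /e !cat_uniq !enum_uniq /= andbT; apply/andP; split; apply/hasPn => k.
    rewrite mem_cat !mem_enum => /orP[kT|]; last by rewrite inE => /andP[].
    by rewrite inE kT.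
  by rewrite !mem_enum inE => /andP[].
have e_all k : k \in e.
  rewrite !mem_cat !mem_enum; case: (boolP (k \in T)); rewrite ?orbT // => kT.
  by case: (boolP (k \in L)) => // kL /=; rewrite inE kT.
have size_e : size e = n.
  rewrite -[RHS](size_enum_ord n); apply: perm_size; apply: uniq_perm => //.
    exact: enum_uniq.
  by move=> k; rewrite mem_enum e_all.
have cLTH : (#|L| + (#|T| + #|H|))%N = n.
  by have := size_e; rewrite !size_cat -!cardE.
have n0 : (0 < n)%N by lia.
have [i0 i0T] : exists i, i \in T by apply/card_gt0P; rewrite cT; lia.
pose s0 (i : 'I_n) := nth i0 e i.
have s0_inj : injective s0.
  move=> i j /eqP; rewrite nth_uniq ?size_e // => /eqP; exact: val_inj.
pose s := perm s0_inj.
have enum_lam (B : {set 'I_n}) : pairwise (fun i j => lam i <= lam j) (enum B).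
  rewrite {1}/enum_mem -enumT; apply: subseq_pairwise (filter_subseq _ _) _.
  apply: (@sub_pairwise _ (relpre val leq)) => [i j|]; first exact: hlam.
  rewrite -pairwise_map val_enum_ord -sorted_pairwise ?iota_sorted //.
  exact: leq_trans.
have LT k j : k \in L -> j \in T -> lam k <= lam j.
  by rewrite inE => /andP[_ /forall_inP h] /h.
(* An index of [H] exceeds some value on [T]; were it also below another, convexity would put it in
   [T]. *)
have TH j k : j \in T -> k \in H -> lam j <= lam k.
  rewrite [in k \in H]inE => jT /andP[kT]; rewrite inE kT /= => /forall_inPn[i iT].
  rewrite -ltNge => ik; rewrite leNgt; apply/negP => kj.
  by rewrite (cvx i j k) in kT.
have lam_e : pairwise (fun i j => lam i <= lam j) e.
  rewrite /e !pairwise_cat !enum_lam !andbT; apply/andP; split; apply/allrelP => i j.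
    rewrite mem_cat !mem_enum => iL /orP[|jH]; first exact: LT.
    by apply: le_trans (TH _ _ i0T jH); apply: LT.
  by rewrite !mem_enum; apply: TH.
(* In the list [e] the block [T] starts at position [#|L|], which is therefore the left end of the
   window. *)
have Lm : (#|L| < m.+1)%N by lia.
exists s, (Ordinal Lm); split.
  apply: nondecreasing_perm => // i j; rewrite leq_eqVlt => /orP[/eqP/val_inj -> //|ij].
  rewrite /= !permE /s0; have /(pairwiseP i0) := lam_e; apply=> //;
  by rewrite inE size_e.
move=> i; rewrite permE /s0 inE /= /e !nth_cat -!cardE.
have iN := ltn_ord i.
case: ltnP => iL /=.
  have : nth i0 (enum L) i \in enum L by rewrite mem_nth // -cardE.
  by rewrite mem_enum inE => /andP[/negPf].
rewrite -cT ltn_subLR //; case: ltnP => iT.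
  by rewrite -mem_enum mem_nth // -cardE ltn_subLR.
have : nth i0 (enum H) (i - #|L| - #|T|) \in enum H.
  by rewrite mem_nth // -cardE -subnDA ltn_subLR // -addnA cLTH.
by rewrite mem_enum inE => /andP[/negPf].
Qed.

(** * Attainment, lower bound and the equality case *)

Lemma window_averaged_nondecreasing (R : realType) (m n l : nat) (lam : 'I_n -> R) :
  (m < n)%N -> (l <= m)%N -> nondecreasing_eigenvalues lam ->
  nondecreasing_eigenvalues (window_averaged m lam l).
Proof.
move=> mn lm hlam i j ij; rewrite /window_averaged.
have r0 : 0 < (n - m)%:R :> R by rewrite ltr0n; lia.
have cst c : \sum_(i in window m n l) c = c * (n - m)%:R :> R.
  by rewrite sumr_const card_window // mulr_natr.
case: ifPn; case: ifPn => // jw iw; last exact: hlam.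
  rewrite /window_mean ler_pdivrMr // -cst; apply: ler_sum => k; move: iw jw.
  by rewrite !inE => ? ? ?; apply: hlam; lia.
rewrite /window_mean ler_pdivlMr // -cst; apply: ler_sum => k; move: iw jw.
by rewrite !inE => ? ? ?; apply: hlam; lia.
Qed.

Lemma sum_sqr_window_averaged (R : realType) (m n l : nat) (lam : 'I_n -> R) :
  \sum_i (window_averaged m lam l i - lam i) ^+ 2 = window_cost m lam l.
Proof.
rewrite /window_cost [RHS]big_mkcond /=; apply: eq_bigr => i _.
by rewrite /window_averaged; case: ifP => _; rewrite -sqrrN opprB // subrr expr0n.
Qed.

(** [Y] is an arbitrary competitor that need not have the [v k] as eigenvectors; the weights
    [|P v_k|^2] stand in for a choice of [n - m] indices. *)
Lemma window_cost_le_sqnorm (R : realType) (m n : nat) (A Y : 'M[R]_n) (lam : 'I_n -> R)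
    (v : 'I_n -> 'cV[R]_n) (l : 'I_m.+1) :
  (m < n)%N -> orthonormal_family v -> eigenpairs A lam v ->
  nondecreasing_eigenvalues lam -> minimizing_window lam l -> in_L m Y ->
  window_cost m lam l <= sqnorm (Y - A).
Proof.
move=> mn hv hA hlam hl /in_L_orth_proj [beta [P [Pp PY Pt]]].
apply: le_trans (sqnorm_orth_proj_le _ Pp).
rewrite (sqnorm_orthonormal _ hv).
have -> : \sum_k sqnorm (P *m (Y - A) *m v k)
    = \sum_k (lam k - beta) ^+ 2 * sqnorm (P *m v k).
  apply: eq_bigr => k _; rewrite mulmxBr mulmxBl PY -mulmxA hA -scalemxAl -scalemxAr.
  by rewrite -scalerBl sqnormZ -sqrrN opprB.
apply: minimizing_window_le => // [k|].
  by rewrite sqnorm_ge0 -(orthonormal_sqnorm k hv) sqnorm_orth_proj_le.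
by rewrite -(sqnorm_orthonormal _ hv) sqnorm_orth_proj.
Qed.

Lemma window_averaged_in_L (R : realType) (m n : nat) (A X : 'M[R]_n) (lam mu : 'I_n -> R)
    (v : 'I_n -> 'cV[R]_n) (s : 'S_n) (l : 'I_m.+1) :
  (m < n)%N -> orthonormal_family v -> eigenpairs A lam v -> eigenpairs X mu v ->
  lam \o s =1 lam -> mu \o s =1 window_averaged m lam l ->
  in_L m X /\ sqnorm (X - A) = window_cost m lam l.
Proof.
move=> mn hv hA hX hs hmu.
have lm : (l <= m)%N by rewrite -ltnS.
split; last first.
  rewrite (sqnorm_eigenpairs_sub hv hA hX) (reindex_inj (@perm_inj _ s)).
  rewrite -sum_sqr_window_averaged; apply: eq_bigr => i _.
  by rewrite -hmu -[in RHS]hs.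
apply: (in_L_of_eigenpairs (beta := window_mean m lam l) (T := s @: window m n l) hv hX).
  rewrite cardsCs setCK (card_imset _ (@perm_inj _ s)) card_window // card_ord; lia.
by move=> k /imsetP[i iw ->]; have := hmu i; rewrite /= /window_averaged iw.
Qed.

(** Supplies the competitor that attains the minimal window cost. *)
Lemma exists_eigenpairs (R : realType) (n : nat) (mu : 'I_n -> R) (v : 'I_n -> 'cV[R]_n) :
  orthonormal_family v -> exists X : 'M[R]_n, eigenpairs X mu v.
Proof.
move=> hv; exists (\sum_k mu k *: (v k *m (v k)^T)) => k.
rewrite mulmx_suml (bigD1 k) //= big1 => [|j /negPf jk]; rewrite -scalemxAl -mulmxA hv.
  by rewrite eqxx mulmx1 addr0.
by rewrite jk mul_mx_scalar scale0r scaler0.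
Qed.

(* Exchanging [i] or [j] for [k] would lower the sum. *)
Lemma minimal_set_convex (R : realType) (n r : nat) (lam : 'I_n -> R) (beta : R)
    (T : {set 'I_n}) :
  #|T| = r ->
  (forall U : {set 'I_n}, #|U| = r ->
     \sum_(i in T) (lam i - beta) ^+ 2 <= \sum_(i in U) (lam i - beta) ^+ 2) ->
  forall i j k, i \in T -> j \in T -> lam i < lam k -> lam k < lam j -> k \in T.
Proof.
move=> cT Tmin i j k iT jT ik kj; apply/negPn/negP => kT.
have exch h : h \in T -> (lam h - beta) ^+ 2 <= (lam k - beta) ^+ 2.
  move=> hT; have kTh : k \notin T :\ h by rewrite !inE (negPf kT) andbF.
  have := Tmin (k |: (T :\ h)); rewrite cardsU1 kTh -cT (cardsD1 h T) hT => /(_ erefl).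
  by rewrite (big_setD1 h hT) big_setU1 //= lerD2r.
have := exch i iT; have := exch j jT.
(* If [lam k <= beta] then [i] is strictly farther from [beta] than [k]; otherwise [j] is. *)
have [kb|kb] := leP (lam k) beta; nra.
Qed.

(** The distance is the cost of [T] plus a nonnegative part off [T]. As the cost of [T] is already
    at least the minimal window cost, both bounds are tight: [mu] agrees with [lam] off [T], and [T]
    has least cost among sets of its size. *)
Lemma optimal_window_averaged (R : realType) (m n : nat) (A X : 'M[R]_n)
    (lam mu : 'I_n -> R) (v : 'I_n -> 'cV[R]_n) (l0 : 'I_m.+1) :
  (m < n)%N -> orthonormal_family v -> eigenpairs A lam v -> eigenpairs X mu v ->
  nondecreasing_eigenvalues lam -> minimizing_window lam l0 ->
  in_L m X -> sqnorm (X - A) <= window_cost m lam l0 ->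
  exists2 s : 'S_n, lam \o s =1 lam &
    exists2 l : 'I_m.+1, minimizing_window lam l & mu \o s =1 window_averaged m lam l.
Proof.
move=> mn hv hA hX hlam hl0 XL; rewrite (sqnorm_eigenpairs_sub hv hA hX) => le0.
have [beta /exists_subset_card [T /subsetP Tsub cT]] := in_L_eigenvalue_multiplicity hv hX XL.
have muT k : k \in T -> mu k = beta by move=> /Tsub; rewrite inE => /eqP.
have Tge := minimizing_window_le_set beta mn hlam hl0.
have split_sum : \sum_k (mu k - lam k) ^+ 2
    = \sum_(k in T) (lam k - beta) ^+ 2 + \sum_(k in ~: T) (mu k - lam k) ^+ 2.
  rewrite (bigID (mem T)) /=; congr (_ + _).
    by apply: eq_bigr => k kT; rewrite muT // -sqrrN opprB.
  by apply: eq_bigl => k; rewrite inE.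
have off_ge0 : 0 <= \sum_(k in ~: T) (mu k - lam k) ^+ 2.
  by apply: sumr_ge0 => k _; apply: sqr_ge0.
have T0 := Tge T cT.
have off0 : \sum_(k in ~: T) (mu k - lam k) ^+ 2 == 0 by apply/eqP; lra.
have muN k : k \notin T -> mu k = lam k.
  move: off0; rewrite psumr_eq0 => [/allP h kT|? _]; last exact: sqr_ge0.
  have := h k (mem_index_enum k).
  by rewrite inE kT /= sqrf_eq0 subr_eq0 => /eqP.
have TE : \sum_(k in T) (lam k - beta) ^+ 2 = window_cost m lam l0 by lra.
have [|s [l [hs sT]]] := @convex_set_window _ m _ lam T mn hlam cT.
  by apply: (minimal_set_convex cT (beta := beta)) => U cU; rewrite TE; apply: Tge.
have lm : (l <= m)%N by rewrite -ltnS.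
have : \sum_(k in T) (lam k - beta) ^+ 2 = \sum_(i in window m n l) (lam i - beta) ^+ 2.
  rewrite (reindex_inj (@perm_inj _ s)) /=.
  by apply: eq_big => [i|i _]; [exact: sT|rewrite -[in RHS]hs].
(* [E] writes the minimal cost as the cost of [l] plus a nonnegative square term. So the square
   vanishes, [beta] is the mean over the window, and [l] is minimizing too. *)
rewrite TE sum_sqr_window // => E.
have r0 : 0 < (n - m)%:R :> R by rewrite ltr0n; lia.
have hl := hl0 l.
have q0 : 0 <= (n - m)%:R * (window_mean m lam l - beta) ^+ 2.
  by rewrite mulr_ge0 ?sqr_ge0 // ltW.
have : (n - m)%:R * (window_mean m lam l - beta) ^+ 2 == 0 by apply/eqP; lra.
rewrite mulf_eq0 gt_eqF //= sqrf_eq0 subr_eq0 => /eqP mean_l.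
exists s => //; exists l => [l'|i]; first by apply: le_trans (hl0 l'); lra.
rewrite /= /window_averaged -sT; case: ifPn => iT; first by rewrite muT.
by rewrite muN //; apply: hs.
Qed.

(* MathComp world.  [lam], [v]: the eigenvalues (nondecreasing) and orthonormal
   eigenvectors of [A]; [mu k]: the eigenvalue of [X] belonging to [v k].  The
   permutation [s] accounts for repeated eigenvalues of [A]: it ranges over the
   ways of indexing the same eigenvectors so that the eigenvalues are
   nondecreasing.  When [mu] is itself nondecreasing no re-indexing is needed. *)
Theorem theorem4 (R : realType) (m n : nat) (hmn : (m < n)%N)
    (A : 'M[R]_n) (hA : A^T = A)
    (lam : 'I_n -> R) (v : 'I_n -> 'cV[R]_n)
    (hv : orthonormal_family v) (hAv : eigenpairs A lam v)
    (hlam : nondecreasing_eigenvalues lam)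
    (X : 'M[R]_n) (mu : 'I_n -> R) (hXv : eigenpairs X mu v) :
  (optimal_solution m A X <->
     exists s : 'S_n,
       (forall k : 'I_n, lam (s k) = lam k) /\
       exists l : 'I_m.+1,
         minimizing_window lam l /\
         forall i : 'I_n, mu (s i) = window_averaged m lam l i)
  /\
  (nondecreasing_eigenvalues mu ->
     (optimal_solution m A X <->
        exists l : 'I_m.+1,
          minimizing_window lam l /\
          forall i : 'I_n, mu i = window_averaged m lam l i)).
Proof.
have [l0 hl0] := @exists_minimizing_window R m n lam.
(* The least squared distance equals the minimal window cost, which turns optimality into an
   inequality on [X] alone. *)
have optP : optimal_solution m A X <-> in_L m X /\ sqnorm (X - A) <= window_cost m lam l0.
  split=> -[XL opt]; split=> //.
    have [Y hY] := exists_eigenpairs (window_averaged m lam l0) hv.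
    have [||YL <-] := @window_averaged_in_L _ _ _ A Y lam _ v 1%g l0 hmn hv hAv hY.
    - by move=> i; rewrite /= perm1.
    - by move=> i; rewrite /= perm1.
    by rewrite -frobenius_norm_le; apply: opt.
  move=> Y YL; rewrite frobenius_norm_le; apply: le_trans opt _.
  exact: (window_cost_le_sqnorm hmn hv hAv).
have fwd : optimal_solution m A X -> exists2 s : 'S_n, lam \o s =1 lam &
    exists2 l : 'I_m.+1, minimizing_window lam l & mu \o s =1 window_averaged m lam l.
  by move=> /optP[XL le0]; apply: (optimal_window_averaged hmn hv hAv hXv hlam hl0).
have bwd (s : 'S_n) (l : 'I_m.+1) : lam \o s =1 lam -> minimizing_window lam l ->
    mu \o s =1 window_averaged m lam l -> optimal_solution m A X.
  move=> hs hl hmu; apply/optP.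
  by have [XL ->] := window_averaged_in_L hmn hv hAv hXv hs hmu.
split; first split.
- by move=> /fwd[s hs [l hl hmu]]; exists s; split=> //; exists l.
- by move=> [s [hs [l [hl hmu]]]]; apply: (bwd s l).
move=> hinc; split=> [/fwd[s hs [l hl hmu]]|[l [hl hmu]]]; last first.
  by apply: (bwd 1%g l) => // i; rewrite /= perm1.
exists l; split=> // i; rewrite -hmu; symmetry; apply: nondecreasing_perm => // j k jk.
by rewrite !hmu; apply: window_averaged_nondecreasing => //; rewrite -ltnS.
Qed.
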